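(* Let $X$ be an r.i. space and let $I$ be a quasiconcave function satisfying $\int_0^t\frac{I(s)}{s}ds\lesssim I(t)$ for $t\in(0,1)$. Then $$\left\|\frac{t}{I(t)}(T_If)^{**}(t)\right\|_X\lesssim\left\|\frac{t}{I(t)}f^{**}(t)\right\|_X,\quad f\in\mathcal M_+(0,1).$$ In other words, $T_I$ is bounded on $(Y_Z)'$ for every r.i. space $Z$, where $Y_Z$ is the optimal target space of $Z$ under $H_I$.
   Context: Functions live on $(0,1)$; $\mathcal M_+(0,1)$ nonnegative measurable functions; $f^*$ nonincreasing rearrangement; $f^{**}(t)=\frac1t\int_0^tf^*$. An r.i. space is a rearrangement-invariant Banach function space on $(0,1)$, $X'$ its associate space ($\|g\|_{X'}=\sup_{\|f\|_X\le1}\int fg$). A quasiconcave function is a nondecreasing bijection $I:(0,1)\to(0,1)$ with $I(0+)=0$, $I(1-)=1$ and $I(t)/t$ nonincreasing. $T_If(t)=\frac{I(t)}{t}\sup_{t\le s<1}\frac{s}{I(s)}f^*(s)$, $H_If(t)=\int_t^1\frac{f(s)}{I(s)}ds$. The optimal target space $Y_Z$ of $Z$ under $H_I$ is the r.i. space with $H_I:Z\to Y_Z$ bounded and $Y_Z\hookrightarrow W$ whenever $H_I:Z\to W$ is bounded for an r.i. space $W$; it is known that $\|g\|_{(Y_Z)'}=\|\frac1{I(t)}\int_0^tg^*(s)ds\|_{Z'}$. $\lesssim$: up to a constant independent of $f$. *)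

(* Defs.v *)
From HB Require Import structures.
From mathcomp Require Import all_boot all_order all_algebra.
From mathcomp Require Import all_classical all_reals all_analysis measurable_realfun.
Set Implicit Arguments. Unset Strict Implicit. Unset Printing Implicit Defensive.
Import Order.TTheory GRing.Theory Num.Theory.
Import numFieldNormedType.Exports.
Local Open Scope classical_set_scope.
Local Open Scope ring_scope.

Section Defs.
Variable R : realType.
Local Notation mu := (@lebesgue_measure R).

Definition I01 : set R := `]0%R, 1%R[.

Definition Mplus (f : R -> \bar R) : Prop :=
  measurable_fun I01 f /\ (forall x, I01 x -> (0 <= f x)%E).

Definition ae01 (P : R -> Prop) : Prop :=
  exists N : set R, [/\ measurable N, mu N = 0%E &
    forall x, I01 x -> ~ N x -> P x].

Definition distr (f : R -> \bar R) (l : R) : \bar R :=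
  mu (I01 `&` [set x | (l%:E < `|f x|)%E]).

Definition fstar (f : R -> \bar R) (t : R) : \bar R :=
  ereal_inf [set l%:E | l in [set l : R | 0 <= l /\ (distr f l <= t%:E)%E]].

Definition fss (f : R -> \bar R) (t : R) : \bar R :=
  ((t^-1)%:E * \int[mu]_(s in `]0%R, t[) fstar f s)%E.

Definition quasiconcave (I : R -> R) : Prop :=
  (forall t, I01 t -> I01 (I t)) /\
      (forall s t, I01 s -> I01 t -> I s = I t -> s = t) /\
      (forall y, I01 y -> exists2 t, I01 t & I t = y) /\
      (forall s t, I01 s -> I01 t -> s <= t -> I s <= I t) /\
      (I @ at_right (0:R) --> (0:R)) /\
      (I @ at_left (1:R) --> (1:R)) /\
      (forall s t, I01 s -> I01 t -> s <= t -> I t / t <= I s / s).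

Definition T_I (I : R -> R) (f : R -> \bar R) (t : R) : \bar R :=
  ((I t / t)%:E *
    ereal_sup [set ((s / I s)%:E * fstar f s)%E | s in `[t, 1%R[])%E.

(* rho is a Banach function norm on M_+(0,1) (Bennett--Sharpley P1--P5) which
   is moreover rearrangement invariant; an r.i. space X is given by its norm
   rho, ||f||_X = rho(|f|). *)
Definition ri_norm (rho : (R -> \bar R) -> \bar R) : Prop :=
  (forall f, Mplus f -> (0 <= rho f)%E) /\
  (forall f, Mplus f -> (rho f = 0%E <-> ae01 (fun x => f x = 0%E))) /\
  (forall f (a : R), Mplus f -> 0 <= a ->
      rho (fun x => (a%:E * f x)%E) = (a%:E * rho f)%E) /\
  (forall f g, Mplus f -> Mplus g ->
      (rho (fun x => f x + g x) <= rho f + rho g)%E) /\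
  (forall f g, Mplus f -> Mplus g -> ae01 (fun x => (g x <= f x)%E) ->
      (rho g <= rho f)%E) /\
  (forall (fs : nat -> R -> \bar R) f, (forall n, Mplus (fs n)) -> Mplus f ->
      ae01 (fun x => (forall m n, (m <= n)%N -> (fs m x <= fs n x)%E)
                     /\ fs n x @[n --> \oo] --> f x) ->
      rho (fs n) @[n --> \oo] --> rho f) /\
  (forall E, measurable E -> E `<=` I01 ->
      (rho (fun x => (\1_E x)%:E) < +oo)%E) /\
  (forall E, measurable E -> E `<=` I01 -> exists C : R,
      forall f, Mplus f -> (\int[mu]_(x in E) f x <= C%:E * rho f)%E) /\
  (forall f g, Mplus f -> Mplus g ->
      (forall t, I01 t -> fstar f t = fstar g t) -> rho f = rho g).

End Defs.

(* Main.v *)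
Require Import Defs.
From HB Require Import structures.
From mathcomp Require Import all_boot all_order all_algebra.
From mathcomp Require Import all_classical all_reals all_analysis measurable_realfun.
From mathcomp Require Import ring lra.
Import Order.TTheory GRing.Theory Num.Theory.
Import numFieldNormedType.Exports.
Local Open Scope classical_set_scope.
Local Open Scope ring_scope.

(* Put F(t) = int_0^t f^*, h(t) = (t/I(t)) f^**(t) = F(t)/I(t) and
   G(t) = sup_(t <= r < 1) (r/I(r)) f^*(r), so that T_I f = (I(t)/t) G(t).
   Since f^* and 1/I decrease, (r/I(r)) f^*(r) <= 2 int_(r/2)^r f^*/I; using this
   for the part r < t of the supremum defining G(s), Tonelli and the averaging
   condition on I give int_0^t T_I f <= 4 C F(t) + C I(t) G(t).  Hence the
   left-hand function is at most 4 C h + C G.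
   If G(2s) is nearly attained at r >= 2s, then h >= G(2s)/3 on (r/3, r), a set of
   measure greater than s; so G(2s) <= 3 h^*(s), and dilation by 2 is bounded on
   every r.i. space. *)

Local Notation mu := (@lebesgue_measure _).
#[local] Arguments I01 {R} _.

(** * Measurability of monotone functions and lengths of intervals *)

Lemma I01E {R : realType} (x : R) : I01 x <-> 0 < x /\ x < 1.
Proof. by rewrite /I01 /= in_itv /=; split=> [/andP[]|[-> ->]]. Qed.

Lemma measurable_I01 {R : realType} : measurable (@I01 R).
Proof. exact: measurable_itv. Qed.

Lemma is_interval_I01 {R : realType} : is_interval (@I01 R).
Proof. exact: interval_is_interval. Qed.

#[local] Hint Extern 0 (measurable _) => solve [exact: measurable_I01] : core.
#[local] Hint Extern 0 (is_interval _) => solve [exact: is_interval_I01] : core.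

(** The rays []r, +oo]] generate the Borel sets, and by monotonicity the preimage of such a ray in
    the interval [D] is again an interval. *)
Lemma nonincreasing_emeasurable {R : realType} (D : set R) (f : R -> \bar R) :
  is_interval D -> {in D &, forall s t, s <= t -> (f t <= f s)%E} ->
  measurable_fun D f.
Proof.
move=> iD f_ni.
apply: (measurability (@ErealGenOInfty.G R) (ErealGenOInfty.measurableE R)).
move=> /= _ [_ [r ->]] <-.
apply: is_interval_measurable => s t /= [Ds fs] [Dt ft] x /andP[sx xt].
have Dx : D x by apply: (iD s t) => //; rewrite sx xt.
split=> //; move: ft; rewrite !in_itv /= !andbT => ft.
by apply: (lt_le_trans ft); apply: f_ni => //; exact: mem_set.
Qed.

Lemma nondecreasing_emeasurable {R : realType} (D : set R) (f : R -> \bar R) :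
  is_interval D -> {in D &, forall s t, s <= t -> (f s <= f t)%E} ->
  measurable_fun D f.
Proof.
move=> iD f_nd.
apply: (measurability (@ErealGenOInfty.G R) (ErealGenOInfty.measurableE R)).
move=> /= _ [_ [r ->]] <-.
apply: is_interval_measurable => s t /= [Ds fs] [Dt ft] x /andP[sx xt].
have Dx : D x by apply: (iD s t) => //; rewrite sx xt.
split=> //; move: fs; rewrite !in_itv /= !andbT => fs.
by apply: (lt_le_trans fs); apply: f_nd => //; exact: mem_set.
Qed.

Lemma lebesgue_itv {R : realType} (x y : R) b1 b2 : x <= y ->
  mu [set` Interval (BSide b1 x) (BSide b2 y)] = (y - x)%:E.
Proof.
rewrite le_eqVlt => /predU1P[->|xy].
  by rewrite lebesgue_measure_itv /= ltxx subrr.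
by rewrite lebesgue_measure_itv /= lte_fin xy EFinB.
Qed.

Lemma integral_cst_itv {R : realType} (x y : R) (c : \bar R) : x <= y ->
  (\int[mu]_(z in `]x, y[) c = c * (y - x)%:E)%E.
Proof.
move=> xy; rewrite -(lebesgue_itv x y false true xy).
exact: (integral_cst (@lebesgue_measure R) (measurable_itv `]x, y[) c).
Qed.

(** Endpoints have measure zero. Superlevel sets of monotone functions can thus be measured without
    deciding whether they contain their endpoints. *)
Lemma measure_itv_squeeze {R : realType} (A : set R) x y : x <= y ->
  measurable A -> `]x, y[ `<=` A -> A `<=` `[x, y] -> mu A = (y - x)%:E.
Proof.
move=> xy mA xyA Axy; apply/eqP; rewrite eq_le; apply/andP; split.
  by rewrite -(lebesgue_itv x y true false) //; apply: le_measure => //; rewrite inE.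
by rewrite -(lebesgue_itv x y false true) //; apply: le_measure => //; rewrite inE.
Qed.

(** * Distribution functions and the nonincreasing rearrangement *)

Lemma measurable_superlevel {R : realType} (f : R -> \bar R) (l : R) :
  measurable_fun I01 f -> measurable (I01 `&` [set x | (l%:E < `|f x|)%E]).
Proof.
move=> mf; apply: emeasurable_fun_o_infty => //.
exact: (measurableT_comp (@abse_measurable R setT)).
Qed.

Lemma fstar_ge0 {R : realType} (f : R -> \bar R) t : (0 <= fstar f t)%E.
Proof. by apply: le_ereal_inf_tmp => _ /= [l [l0 _] <-]; rewrite lee_fin. Qed.

Lemma fstar_le {R : realType} (f : R -> \bar R) l t :
  0 <= l -> (distr f l <= t%:E)%E -> (fstar f t <= l%:E)%E.
Proof. by move=> l0 fl; apply: ereal_inf_lbound; exists l. Qed.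

Lemma fstar_nonincreasing {R : realType} (f : R -> \bar R) s t :
  s <= t -> (fstar f t <= fstar f s)%E.
Proof.
move=> st; apply: ereal_inf_le_tmp => _ [l [l0 fl] <-]; exists l => //; split=> //.
by rewrite (le_trans fl) // lee_fin.
Qed.

Lemma measurable_fstar {R : realType} (f : R -> \bar R) D :
  measurable_fun D (fstar f).
Proof.
apply: (@measurable_funS _ _ _ _ setT) => //.
by apply: nonincreasing_emeasurable => // s t _ _; exact: fstar_nonincreasing.
Qed.

Lemma Mplus_fstar {R : realType} (f : R -> \bar R) : Mplus (fstar f).
Proof. by split=> [|x _]; [exact: measurable_fstar|exact: fstar_ge0]. Qed.

Lemma eq_distr_fstar {R : realType} (f g : R -> \bar R) :
  (forall l, 0 <= l -> distr f l = distr g l) -> fstar f = fstar g.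
Proof.
move=> fg; apply/funext => t; congr (ereal_inf _); congr (_ @` _).
by apply/seteqP; split=> l [l0]; [rewrite fg|rewrite -fg].
Qed.

Lemma distr_le_nonincreasing {R : realType} (f : R -> \bar R) l m :
  measurable_fun I01 f -> l <= m -> (distr f m <= distr f l)%E.
Proof.
move=> mf lm; apply: le_measure; rewrite ?inE; try exact: measurable_superlevel.
by move=> x /= [Ix fx]; split=> //; apply: le_lt_trans fx; rewrite lee_fin.
Qed.

(** Converse of [fstar_le], by right continuity of the distribution function: the set where |f| > l
    is the increasing union of the sets where |f| > l + 1/(n+1), each of measure at most t. *)
Lemma fstar_distr_le {R : realType} (f : R -> \bar R) l t :
  measurable_fun I01 f -> (fstar f t <= l%:E)%E -> (distr f l <= t%:E)%E.
Proof.
move=> mf ftl.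
pose F n := I01 `&` [set x | ((l + n.+1%:R^-1)%:E < `|f x|)%E].
have mF n : measurable (F n) by exact: measurable_superlevel.
have FE : \bigcup_n F n = I01 `&` [set x | (l%:E < `|f x|)%E].
  apply/seteqP; split=> x /=.
    move=> [n _ [Ix fx]]; split=> //; apply: lt_trans fx.
    by rewrite lte_fin ltrDl invr_gt0.
  move=> [Ix]; case E: `|f x|%E => [r| |] // lr; last first.
    by exists 0%N; split=> //=; rewrite E ltry.
  rewrite lte_fin in lr; have [n nrl] := ltr_add_invr lr.
  by exists n => //; split=> //=; rewrite E lte_fin.
have := @nondecreasing_cvg_mu _ _ _ (@lebesgue_measure R) F mF.
rewrite FE => /(_ (measurable_superlevel _ l mf)) cF.
apply: cvge_le (cF _).
  apply: nearW => n /=; have : (fstar f t < (l + n.+1%:R^-1)%:E)%E.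
    by apply: (le_lt_trans ftl); rewrite lte_fin ltrDl invr_gt0.
  move=> /ereal_inf_lt[_ [m [m0 fm] <-]]; rewrite lte_fin => ml.
  by apply: le_trans fm; apply: distr_le_nonincreasing => //; exact: ltW.
move=> m n mn; apply/subsetPset => x /= [Ix fx]; split=> //.
by apply: le_lt_trans fx; rewrite lee_fin lerD2l lef_pV2 ?posrE // ler_nat.
Qed.

(** By [fstar_le] and [fstar_distr_le], [fstar f x] exceeds l exactly when x < [distr f l], so the
    superlevel set of [fstar f] is the interval from 0 to [distr f l]. *)
Lemma distr_fstar {R : realType} (f : R -> \bar R) l :
  measurable_fun I01 f -> 0 <= l -> distr (fstar f) l = distr f l.
Proof.
move=> mf l0.
have df0 : (0 <= distr f l)%E by exact: measure_ge0.
(* The bound by the measure of [I01] makes [distr f l] a real number in [0, 1], usable as an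
   interval endpoint. *)
have df1 : (distr f l <= 1)%E.
  have -> : 1%E = mu (@I01 R) by rewrite lebesgue_itv // subr0.
  by apply: le_measure; rewrite ?inE //; exact: measurable_superlevel.
have dfE : distr f l = (fine (distr f l))%:E.
  by rewrite fineK // ge0_fin_numE // (le_lt_trans df1) // ltry.
set a := fine _ in dfE.
have a0 : 0 <= a by rewrite -lee_fin -dfE.
have a1 : a <= 1 by rewrite -lee_fin -dfE.
rewrite dfE -[RHS]/(a%:E) -[a in RHS]subr0 -(lebesgue_itv 0 a false true a0).
rewrite /distr; congr (mu _); apply/seteqP; split=> x /=.
  move=> [/I01E[x0 x1]]; rewrite gee0_abs ?fstar_ge0 // => lx.
  rewrite in_itv /= x0 /= -lte_fin -dfE ltNge; apply/negP => xa.
  by move: lx; rewrite ltNge fstar_le.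
rewrite in_itv /= => /andP[x0 xa]; split.
  by apply/I01E; split=> //; exact: lt_le_trans a1.
rewrite gee0_abs ?fstar_ge0 // ltNge; apply/negP => /(fstar_distr_le _ _ _ mf).
by rewrite dfE lee_fin leNgt xa.
Qed.

Lemma fstar_fstar {R : realType} (f : R -> \bar R) :
  measurable_fun I01 f -> fstar (fstar f) = fstar f.
Proof. by move=> mf; apply: eq_distr_fstar => l l0; exact: distr_fstar. Qed.

(** * Dilation by 2 on rearrangement-invariant spaces *)

(** The number a is the supremum of the superlevel set, with 0 adjoined so that the set is never
    empty. Whether a itself belongs to it is left open. *)
Lemma superlevel_nonincreasing {R : realType} (g : R -> \bar R) (l : \bar R) :
  {in I01 &, forall s t, s <= t -> (g t <= g s)%E} ->
  exists a, [/\ 0 <= a <= 1, forall s, I01 s -> s < a -> (l < g s)%E &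
                forall s, I01 s -> (l < g s)%E -> s <= a].
Proof.
move=> g_ni; pose S := [set s | s = 0 \/ I01 s /\ (l < g s)%E].
have S0 : S 0 by left.
have S1 : ubound S 1 by move=> s [->|[/I01E[_ /ltW]]].
have hS : has_sup S by split; [exists 0|exists 1].
exists (sup S); split.
- by rewrite ub_le_sup //=; [apply: ge_sup; first exists 0 | exists 1].
- move=> s Is /(sup_gt (ex_intro _ _ S0))[x [->|[Ix lx]] sx].
    by move/I01E: Is => [s0 _]; move: (lt_trans sx s0); rewrite ltxx.
  by apply: (lt_le_trans lx); apply: g_ni; rewrite ?inE //; exact: ltW.
- by move=> s Is ls; apply: ub_le_sup; [exists 1|right].
Qed.

(** The dilate of [g], cut off at 1/2 because 2s leaves (0, 1) from there on. *)
Definition compress {R : realType} (g : R -> \bar R) (s : R) : \bar R :=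
  if s < 2^-1 then g (2 * s) else 0%E.

Section Compress.
Context {R : realType} (g : R -> \bar R).
Hypothesis g0 : forall s, I01 s -> (0 <= g s)%E.
Hypothesis g_ni : {in I01 &, forall s t, s <= t -> (g t <= g s)%E}.

Let k := compress g.
Let k' s := k (1 - s).

Lemma Mplus_nonincreasing : Mplus g.
Proof. by split=> //; exact: nonincreasing_emeasurable. Qed.

Lemma I01_double (s : R) : I01 s -> s < 2^-1 -> I01 (2 * s).
Proof. by move=> /I01E[s0 _] s2; apply/I01E; split; lra. Qed.

Lemma I01_reflect (s : R) : I01 s -> I01 (1 - s).
Proof. by move=> /I01E[s0 s1]; apply/I01E; split; lra. Qed.

Lemma compress_ge0 s : I01 s -> (0 <= k s)%E.
Proof. by move=> Is; rewrite /k /compress; case: ifP => // s2; exact/g0/I01_double. Qed.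

Lemma compress_nonincreasing : {in I01 &, forall s t, s <= t -> (k t <= k s)%E}.
Proof.
move=> s t; rewrite !inE => Is It st; have := compress_ge0 _ Is.
rewrite {2}/k /compress; case: ifPn => [t2 _|//].
rewrite /k /compress (le_lt_trans st t2) g_ni ?inE; first by [].
- exact: I01_double (le_lt_trans st t2).
- exact: I01_double.
- by rewrite ler_pM2l.
Qed.

Lemma Mplus_compress : Mplus k.
Proof.
split; last exact: compress_ge0.
by apply: nonincreasing_emeasurable => //; exact: compress_nonincreasing.
Qed.

Lemma Mplus_reflect : Mplus k'.
Proof.
split=> [|s /I01_reflect]; last exact: compress_ge0.
apply: nondecreasing_emeasurable => // s t; rewrite !inE => Is It st.
apply: compress_nonincreasing; rewrite ?inE; try exact: I01_reflect.
by rewrite lerD2l lerN2.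
Qed.

(** Up to endpoints, the superlevel set of [k] is (0, a) and that of its mirror image is (1 - a,
    1). *)
Lemma distr_reflect (l : R) : 0 <= l -> distr k' l = distr k l.
Proof.
move=> l0; have [a [a01 alt agt]] := superlevel_nonincreasing k l%:E compress_nonincreasing.
have mk := measurable_superlevel _ l (proj1 Mplus_compress).
have mk' := measurable_superlevel _ l (proj1 Mplus_reflect).
transitivity ((a - 0)%:E : \bar R).
  transitivity ((1 - (1 - a))%:E : \bar R); last by congr EFin; lra.
  apply: measure_itv_squeeze => //; first lra.
  - move=> s /=; rewrite in_itv /= => /andP[sa s1].
    have Is : I01 s by apply/I01E; split=> //; lra.
    have Is' := I01_reflect _ Is.
    by split=> //; rewrite gee0_abs ?compress_ge0 //; apply: alt => //; lra.
  - move=> s /= [Is]; have Is' := I01_reflect _ Is.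
    rewrite gee0_abs ?compress_ge0 // => /(agt _ Is') sa.
    by rewrite in_itv /=; case/I01E : Is => _ /ltW ->; rewrite andbT; lra.
symmetry; apply: measure_itv_squeeze => //; first lra.
- move=> s /=; rewrite in_itv /= => /andP[s0 sa].
  have Is : I01 s by apply/I01E; split=> //; lra.
  by split=> //; rewrite gee0_abs ?compress_ge0 //; exact: alt.
- move=> s /= [Is]; rewrite gee0_abs ?compress_ge0 // => /(agt _ Is) sa.
  by rewrite in_itv /= sa andbT; case/I01E : Is => /ltW.
Qed.

(** [k] and [k'] live on the two disjoint halves of (0, 1), so the superlevel sets add up. If that
    of [g] is (0, a) up to its endpoint, each half contributes a/2. *)
Lemma distr_compressD (l : R) : 0 <= l ->
  distr (fun s => k s + k' s)%E l = distr g l.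
Proof.
move=> l0; have [a [a01 alt agt]] := superlevel_nonincreasing g l%:E g_ni.
have mg := measurable_superlevel _ l (proj1 Mplus_nonincreasing).
have mk := measurable_superlevel _ l (proj1 Mplus_compress).
have mk' := measurable_superlevel _ l (proj1 Mplus_reflect).
(* Since l >= 0, the default value 0 of [compress] never exceeds l. *)
have k_half s : I01 s -> (l%:E < k s)%E -> s < 2^-1.
  by move=> _; rewrite /k /compress; case: ifP => // _; rewrite lte_fin ltNge l0.
have -> : distr (fun s => k s + k' s)%E l = (distr k l + distr k' l)%E.
  rewrite /distr -measureU //.
    congr (mu _); apply/seteqP; split=> s /=.
      move=> [Is]; have ks := compress_ge0 _ Is.
      have k's : (0 <= k' s)%E by exact/compress_ge0/I01_reflect.
      rewrite gee0_abs ?adde_ge0 // => lk.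
      have [s2|s2] := ltP s 2^-1.
        left; split=> //; rewrite gee0_abs //; move: lk.
        have -> : k' s = 0%E; last by rewrite adde0.
        by rewrite /k' /k /compress ifF //; apply/negbTE; rewrite -leNgt; lra.
      right; split=> //; rewrite gee0_abs //; move: lk.
      have -> : k s = 0%E; last by rewrite add0e.
      by rewrite /k /compress ltNge s2.
    have kk s' : I01 s' -> (0 <= k s' + k' s')%E.
      by move=> Is; rewrite adde_ge0 // compress_ge0 //; exact: I01_reflect.
    move=> [[Is]|[Is]]; rewrite gee0_abs ?compress_ge0 //; try exact: I01_reflect.
      move=> ls; split=> //; rewrite gee0_abs ?kk //; apply: (lt_le_trans ls).
      by rewrite leeDl // compress_ge0 //; exact: I01_reflect.
    move=> ls; split=> //; rewrite gee0_abs ?kk //; apply: (lt_le_trans ls).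
    by rewrite leeDr // compress_ge0.
  apply/seteqP; split=> // s /= [[Is]]; rewrite gee0_abs ?compress_ge0 // => /(k_half _ Is) s2.
  move=> [_]; have Is' := I01_reflect _ Is.
  by rewrite gee0_abs ?compress_ge0 // => /(k_half _ Is'); lra.
have -> : distr g l = (a - 0)%:E.
  apply: measure_itv_squeeze => //; first lra.
  - move=> s /=; rewrite in_itv /= => /andP[s0 sa].
    have Is : I01 s by apply/I01E; split=> //; lra.
    by split=> //; rewrite gee0_abs ?g0 //; exact: alt.
  - move=> s /= [Is]; rewrite gee0_abs ?g0 // => /(agt _ Is) sa.
    by rewrite in_itv /= sa andbT; case/I01E : Is => /ltW.
have kE : distr k l = (a / 2 - 0)%:E.
  apply: measure_itv_squeeze => //; first lra.
  - move=> s /=; rewrite in_itv /= => /andP[s0 sa].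
    have Is : I01 s by apply/I01E; split=> //; lra.
    have s2 : s < 2^-1 by lra.
    split=> //; rewrite gee0_abs ?compress_ge0 // /k /compress s2.
    by apply: alt; [exact: I01_double|lra].
  - move=> s /= [Is]; rewrite gee0_abs ?compress_ge0 // => ls.
    have s2 := k_half _ Is ls; move: ls; rewrite /k /compress s2.
    move=> /(agt _ (I01_double _ Is s2)) sa.
    by rewrite in_itv /=; case/I01E : Is => /ltW -> _ /=; lra.
by rewrite distr_reflect // kE -EFinD; congr EFin; lra.
Qed.

(* [g] is equimeasurable with [k + k'], where [k] is [g] compressed to (0, 1/2)
   and [k'] its mirror image, so rearrangement invariance bounds a dilation. *)
Lemma ri_norm_compress (rho : (R -> \bar R) -> \bar R) :
  ri_norm rho -> (rho g <= rho k + rho k)%E.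
Proof.
move=> [_ [_ [_ [rhoD [_ [_ [_ [_ rho_eq]]]]]]]].
have Mkk' : Mplus (fun s => k s + k' s)%E.
  split.
    by apply: emeasurable_funD; [case: Mplus_compress|case: Mplus_reflect].
  by move=> s Is; rewrite adde_ge0 ?compress_ge0 //; exact: I01_reflect.
rewrite {2}(_ : rho k = rho k'); last first.
  apply: rho_eq => [||t _]; [exact: Mplus_compress|exact: Mplus_reflect|].
  by congr (_ t); apply: eq_distr_fstar => l l0; rewrite distr_reflect.
rewrite (_ : rho g = rho (fun s => k s + k' s)%E).
  by apply: rhoD; [exact: Mplus_compress|exact: Mplus_reflect].
apply: rho_eq => // [|t _]; first exact: Mplus_nonincreasing.
by congr (_ t); apply: eq_distr_fstar => l l0; rewrite distr_compressD.
Qed.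

(** The hypothesis bounds [k] by c times [fstar h] on (0, 1/2), and elsewhere [k] is 0. As [h] and
    [fstar h] have the same norm, the norm of [k] is at most c times that of [h]; the factor 2 comes
    from [ri_norm_compress]. *)
Lemma ri_norm_le_dilation (rho : (R -> \bar R) -> \bar R) (h : R -> \bar R) (c : R) :
  ri_norm rho -> Mplus h -> 0 <= c ->
  (forall s, I01 s -> s < 2^-1 -> (g (2 * s) <= c%:E * fstar h s)%E) ->
  (rho g <= (2 * c)%:E * rho h)%E.
Proof.
move=> rirho Mh c0 gh; apply: (le_trans (ri_norm_compress _ rirho)).
case: rirho => [rho0 [_ [rhoZ [_ [rho_le [_ [_ [_ rho_eq]]]]]]]].
have Mch : Mplus (fun x => c%:E * fstar h x)%E.
  split=> [|x _]; last by rewrite mule_ge0 ?lee_fin // fstar_ge0.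
  by apply: emeasurable_funM => //; exact: measurable_fstar.
have kh : (rho k <= c%:E * rho h)%E.
  rewrite (_ : rho h = rho (fstar h)); last first.
    apply: rho_eq => // [|t _]; first exact: Mplus_fstar.
    by rewrite fstar_fstar //; case: Mh.
  rewrite -rhoZ //; last exact: Mplus_fstar.
  apply: rho_le => //; first exact: Mplus_compress.
  exists set0; split=> // s Is _; rewrite /k /compress; case: ifP => s2; first exact: gh.
  by rewrite mule_ge0 ?lee_fin // fstar_ge0.
rewrite mulr_natl mulr2n EFinD ge0_muleDl ?lee_fin //.
by apply: leeD.
Qed.
End Compress.

(** * Tonelli's theorem on the region s < 2x *)

Lemma integral_mkcond_itv {R : realType} (i : interval R) (f : R -> \bar R) :
  (\int[mu]_(x in [set` i]) f x = \int[mu]_x (if x \in i then f x else 0))%E.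
Proof.
rewrite integral_mkcond; congr (integral _ _ _); apply/funext => x.
by rewrite /patch; case: ifPn => [/set_mem /= -> //|/negP xi];
   case: ifPn => // ix; case: xi; rewrite inE.
Qed.

Lemma measurable_mkcond_itv {R : realType} (i : interval R) (f : R -> \bar R) :
  measurable_fun [set` i] f ->
  measurable_fun setT (fun x => if x \in i then f x else 0%E).
Proof.
move=> mf; rewrite (_ : (fun _ => _) = f \_ [set` i]).
  by apply/(measurable_restrictT _ (measurable_itv i)).
apply/funext => x; rewrite /patch; case: ifPn => [ix|/negP xi].
  by rewrite ifT //; rewrite inE.
by rewrite ifF //; apply/negP => /set_mem.
Qed.

(** Both sides integrate a(s) b(x) over the part of the square (0, t) x (0, t) where s < 2x. *)
Lemma tonelli_triangle {R : realType} (t : R) (a b : R -> \bar R) :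
  measurable_fun `]0, t[ a -> measurable_fun `]0, t[ b ->
  (forall s, s \in `]0, t[ -> (0 <= a s)%E) ->
  (forall x, x \in `]0, t[ -> (0 <= b x)%E) ->
  (\int[mu]_(s in `]0%R, t[) \int[mu]_(x in `](s / 2)%R, t[) (a s * b x) =
   \int[mu]_(x in `]0%R, t[) \int[mu]_(s in `]0%R, (Num.min (2 * x) t)%R[) (a s * b x))%E.
Proof.
move=> ma mb a0 b0.
(* Extension by zero moves the moving limits of integration into the integrand [phi] on the whole
   plane. *)
pose a' s := if s \in `]0, t[ then a s else 0%E.
pose b' s := if s \in `]0, t[ then b s else 0%E.
pose phi (z : R * R) := if z.1 < 2 * z.2 then (a' z.1 * b' z.2)%E else 0%E.
have a'0 s : (0 <= a' s)%E by rewrite /a'; case: ifPn => // /a0.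
have b'0 s : (0 <= b' s)%E by rewrite /b'; case: ifPn => // /b0.
have phi0 z : (0 <= phi z)%E by rewrite /phi; case: ifP => // _; rewrite mule_ge0.
have mphi : measurable_fun setT phi.
  apply: measurable_fun_ifT => //.
  - by apply: measurable_fun_ltr => //; apply: measurable_funM => //.
  - apply: emeasurable_funM.
    + by apply: (measurableT_comp (f := a')) => //; exact: measurable_mkcond_itv.
    + by apply: (measurableT_comp (f := b')) => //; exact: measurable_mkcond_itv.
rewrite !integral_mkcond_itv.
transitivity (\int[mu]_s \int[mu]_x phi (s, x))%E; [|rewrite fubini_tonelli //];
  congr (integral _ _ _); apply/funext => y.
- case: ifPn => [Dy|/negbTE yD].
    rewrite integral_mkcond_itv; congr (integral _ _ _); apply/funext => x.
    rewrite /phi /a' /b' /= Dy; move: Dy; rewrite !in_itv /= => /andP[y0 yt].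
    case: (ltP y (2 * x)) => yx; last by rewrite ifF //; lra.
    have -> : y / 2 < x by lra.
    have -> : 0 < x by lra.
    by case: ifP; rewrite ?mule0.
  by rewrite integral0_eq // => x _; rewrite /phi /a' /= yD mul0e; case: ifP.
- case: ifPn => [Dy|/negbTE yD].
    rewrite integral_mkcond_itv; congr (integral _ _ _); apply/funext => x.
    rewrite /phi /a' /b' /= Dy; move: Dy; rewrite !in_itv /= => /andP[y0 yt].
    rewrite lt_min; case: (ltP x (2 * y)) => xy /=; last by rewrite andbF.
    by case: ifP; rewrite ?mul0e.
  by rewrite integral0_eq // => x _; rewrite /phi /b' /= yD mule0; case: ifP.
Qed.

(** * Quasiconcave functions, the operator [T_I] and the function F/I *)

Section Quasiconcave.
Context {R : realType} (I : R -> R).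
Hypothesis qI : quasiconcave I.

Lemma quasiconcave_gt0 t : I01 t -> 0 < I t.
Proof. by case: qI => IE _ /IE /I01E[]. Qed.

Lemma quasiconcave_le s t : I01 s -> I01 t -> s <= t -> I s <= I t.
Proof. by case: qI => [_ [_ [_ [I_nd _]]]]; exact: I_nd. Qed.

Lemma quasiconcave_ratio_le s t : I01 s -> I01 t -> s <= t -> I t / t <= I s / s.
Proof. by case: qI => [_ [_ [_ [_ [_ [_ I_ni]]]]]]; exact: I_ni. Qed.

Lemma quasiconcave_ratio_ge0 t : I01 t -> 0 <= I t / t.
Proof.
by move=> It; rewrite divr_ge0 // ltW ?quasiconcave_gt0 //; case/I01E : It.
Qed.

Lemma quasiconcave_inv_ratio_ge0 t : I01 t -> 0 <= t / I t.
Proof. by move=> It; rewrite -invf_div invr_ge0 quasiconcave_ratio_ge0. Qed.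

Lemma quasiconcave_inv_ratio_le s t : I01 s -> I01 t -> s <= t -> s / I s <= t / I t.
Proof.
move=> Is It st; have Is0 := quasiconcave_gt0 _ Is; have It0 := quasiconcave_gt0 _ It.
have [[s0 _] [t0 _]] := (proj1 (I01E s) Is, proj1 (I01E t) It).
rewrite -(invf_div (I s)) -(invf_div (I t)) lef_pV2 ?posrE ?divr_gt0 //.
exact: quasiconcave_ratio_le.
Qed.

(** As I(t)/t is nonincreasing, I(y) <= (y/x) I(x), and y/x <= 2. *)
Lemma quasiconcave_double x y : I01 x -> I01 y -> x <= y -> y <= 2 * x -> I y <= 2 * I x.
Proof.
move=> Ix Iy xy yx; have Ix0 := quasiconcave_gt0 _ Ix.
have [[x0 _] [y0 _]] := (proj1 (I01E x) Ix, proj1 (I01E y) Iy).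
have := quasiconcave_ratio_le _ _ Ix Iy xy; rewrite ler_pdivrMr // => /le_trans; apply.
have : I x * y <= I x * (2 * x) by rewrite ler_pM2l.
by rewrite mulrAC ler_pdivrMr //; lra.
Qed.

Lemma measurable_ratio : measurable_fun I01 (fun s => (I s / s)%:E).
Proof.
apply: nonincreasing_emeasurable => // s t; rewrite !inE => Is It st.
by rewrite lee_fin quasiconcave_ratio_le.
Qed.

Lemma measurable_inv_ratio : measurable_fun I01 (fun s => (s / I s)%:E).
Proof.
apply: nondecreasing_emeasurable => // s t; rewrite !inE => Is It st.
by rewrite lee_fin quasiconcave_inv_ratio_le.
Qed.

Variable f : R -> \bar R.

(** The supremum factor of [T_I], called G in the overview. *)
Definition weighted_sup (t : R) : \bar R :=
  ereal_sup [set ((s / I s)%:E * fstar f s)%E | s in `[t, 1%R[].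

Lemma weighted_sup_ge0 t : I01 t -> (0 <= weighted_sup t)%E.
Proof.
move=> It; apply: le_ereal_sup_tmp; exists ((t / I t)%:E * fstar f t)%E.
  by exists t => //=; rewrite in_itv /= lexx; case/I01E : It.
by rewrite mule_ge0 ?fstar_ge0 // lee_fin quasiconcave_inv_ratio_ge0.
Qed.

Lemma weighted_sup_nonincreasing :
  {in I01 &, forall s t, s <= t -> (weighted_sup t <= weighted_sup s)%E}.
Proof.
move=> s t _ _ st; apply: ereal_sup_le => _ [r /= + <-]; rewrite in_itv /= => /andP[tr r1].
by exists r => //=; rewrite in_itv /= r1 (le_trans st).
Qed.

Lemma T_I_ge0 t : I01 t -> (0 <= T_I I f t)%E.
Proof. by move=> It; rewrite mule_ge0 ?weighted_sup_ge0 // lee_fin quasiconcave_ratio_ge0. Qed.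

(** Both factors, I(t)/t and the supremum, are nonnegative and nonincreasing. *)
Lemma T_I_nonincreasing : {in I01 &, forall s t, s <= t -> (T_I I f t <= T_I I f s)%E}.
Proof.
move=> s t s01 t01 st; move: (s01) (t01); rewrite !inE => Is It.
apply: lee_pmul; rewrite ?lee_fin.
- exact: quasiconcave_ratio_ge0.
- exact: weighted_sup_ge0.
- exact: quasiconcave_ratio_le.
- exact: weighted_sup_nonincreasing.
Qed.

Lemma Mplus_T_I : Mplus (T_I I f).
Proof.
split; last exact: T_I_ge0.
by apply: nonincreasing_emeasurable; [exact: is_interval_I01|exact: T_I_nonincreasing].
Qed.

(** Since [T_I I f] is nonincreasing, it can exceed its value at t only on (0, t), a set of measure
    t; that value is therefore an admissible level in the infimum. *)
Lemma fstar_T_I_le t : I01 t -> (fstar (T_I I f) t <= T_I I f t)%E.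
Proof.
move=> It; have := T_I_ge0 _ It; case E : (T_I I f t) => [l| |] // l0; last by rewrite leey.
rewrite lee_fin in l0; apply: fstar_le => //.
have [t0 t1] := proj1 (I01E t) It.
have -> : t%:E = mu `]0, t[ by rewrite lebesgue_itv ?subr0 // ltW.
have mT := measurable_superlevel _ l (proj1 Mplus_T_I).
apply: le_measure; rewrite ?inE; [exact: mT|exact: measurable_itv|].
move=> s /= [Is]; rewrite gee0_abs ?T_I_ge0 // -E => lTs.
rewrite in_itv /=; case/I01E : (Is) => -> _ /=; rewrite ltNge; apply/negP => ts.
by move: lTs; rewrite ltNge T_I_nonincreasing ?inE.
Qed.

(** The primitive F of the overview. *)
Definition fstar_int (t : R) : \bar R := (\int[mu]_(s in `]0%R, t[) fstar f s)%E.

Lemma fstar_int_ge0 t : (0 <= fstar_int t)%E.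
Proof. by apply: integral_ge0 => s _; exact: fstar_ge0. Qed.

Lemma fstar_int_nondecreasing s t : s <= t -> (fstar_int s <= fstar_int t)%E.
Proof.
move=> st; apply: ge0_subset_integral => //; try exact: measurable_itv.
- exact: measurable_fstar.
- by move=> x _; exact: fstar_ge0.
- by move=> x /=; rewrite !in_itv /= => /andP[-> xs]; exact: lt_le_trans st.
Qed.

Lemma Mplus_weighted_fss : Mplus (fun t => ((t / I t)%:E * fss f t)%E).
Proof.
split=> [|t It].
  apply: emeasurable_funM; first exact: measurable_inv_ratio.
  apply: emeasurable_funM.
    apply: nonincreasing_emeasurable => // s t; rewrite !inE => /I01E[s0 _] /I01E[t0 _] st.
    by rewrite lee_fin lef_pV2.
  by apply: nondecreasing_emeasurable => // s t _ _; exact: fstar_int_nondecreasing.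
rewrite mule_ge0 ?lee_fin ?quasiconcave_inv_ratio_ge0 // mule_ge0 ?fstar_int_ge0 //.
by rewrite lee_fin invr_ge0 ltW //; case/I01E : It.
Qed.

Lemma weighted_fssE t : I01 t ->
  ((t / I t)%:E * fss f t = (I t)^-1%:E * fstar_int t)%E.
Proof.
move=> /I01E[t0 _]; rewrite /fss muleA -EFinM; congr (_%:E * _)%E.
by rewrite mulrAC divff ?mul1r // gt_eqF.
Qed.

End Quasiconcave.

(** * Pointwise estimates for the supremum and for [T_I] *)

Section Estimates.
Context {R : realType} (I : R -> R) (f : R -> \bar R).
Hypothesis qI : quasiconcave I.

Let h t := ((t / I t)%:E * fss f t)%E.
Let G := weighted_sup I f.
Let b x := ((I x)^-1%:E * fstar f x)%E.

Lemma quasiconcave_inv_le s t : I01 s -> I01 t -> s <= t -> (I t)^-1 <= (I s)^-1.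
Proof. by move=> Is It st; rewrite lef_pV2 ?posrE ?quasiconcave_gt0 // quasiconcave_le. Qed.

Lemma quotient_fstar_ge0 x : I01 x -> (0 <= b x)%E.
Proof.
by move=> Ix; rewrite mule_ge0 ?fstar_ge0 // lee_fin invr_ge0 ltW // quasiconcave_gt0.
Qed.

Lemma quotient_fstar_nonincreasing :
  {in I01 &, forall s t, s <= t -> (b t <= b s)%E}.
Proof.
move=> s t; rewrite !inE => Is It st; apply: lee_pmul; rewrite ?fstar_ge0 ?lee_fin //.
- by rewrite invr_ge0 ltW // quasiconcave_gt0.
- exact: quasiconcave_inv_le.
- exact: fstar_nonincreasing.
Qed.

Lemma measurable_quotient_fstar D : D `<=` I01 -> measurable_fun D b.
Proof.
move=> DI; apply: (measurable_funS measurable_I01 DI).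
apply: nonincreasing_emeasurable; first exact: is_interval_I01.
exact: quotient_fstar_nonincreasing.
Qed.

Lemma subitv_I01 (x y : R) : 0 <= x -> y <= 1 -> `]x, y[ `<=` @I01 R.
Proof.
move=> x0 y1 s; rewrite /= in_itv /= => /andP[xs sy].
by apply/I01E; split; [exact: le_lt_trans xs|exact: lt_le_trans y1].
Qed.

(** The quotient [b] is nonincreasing, so on (r/2, r) it is at least its value at r; the length r/2
    accounts for the factor 2. *)
Lemma weighted_fstar_le r : I01 r ->
  ((r / I r)%:E * fstar f r <= 2%:E * \int[mu]_(x in `](r / 2)%R, r[) b x)%E.
Proof.
move=> Ir; have [r0 r1] := proj1 (I01E r) Ir.
have sub : `](r / 2), r[ `<=` @I01 R by apply: subitv_I01; lra.
have : (\int[mu]_(x in `](r / 2)%R, r[) b r <= \int[mu]_(x in `](r / 2)%R, r[) b x)%E.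
  apply: ge0_le_integral; rewrite /=; first exact: measurable_itv.
  - by move=> x _; exact: quotient_fstar_ge0.
  - exact: measurable_cst.
  - exact: measurable_quotient_fstar.
  - move=> x xr; apply: quotient_fstar_nonincreasing; rewrite ?inE //; first exact: sub.
    by move: xr; rewrite /= in_itv /= => /andP[_ /ltW].
rewrite integral_cst_itv; last lra.
move=> /(lee_wpmul2l (_ : 0 <= 2%:E)%E) H; apply: le_trans (H _); last by rewrite lee_fin.
rewrite /b -muleA [(_ * (r - _)%:E)%E]muleC !muleA -!EFinM.
rewrite (_ : r / I r = 2 * (I r)^-1 * (r - r / 2)) //.
by field; rewrite gt_eqF // quasiconcave_gt0.
Qed.

Lemma integral_quotient_le (x y x' y' : R) : 0 <= x -> y <= 1 -> x <= x' -> y' <= y ->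
  (\int[mu]_(z in `]x', y'[) b z <= \int[mu]_(z in `]x, y[) b z)%E.
Proof.
move=> x0 y1 xx' yy'; apply: ge0_subset_integral; try exact: measurable_itv.
- by apply: measurable_quotient_fstar; exact: subitv_I01.
- by move=> z zxy; apply/quotient_fstar_ge0/(subitv_I01 x y).
- move=> z /=; rewrite !in_itv /= => /andP[xz zy].
  by rewrite (le_lt_trans xx') // (lt_le_trans zy).
Qed.

(* Terms of the supremum with [r < t] are averages of [fstar f / I] over
   [(r/2, r)], hence are controlled by an integral instead of a supremum. *)
Lemma T_I_le t s : I01 t -> I01 s -> s < t ->
  (T_I I f s <= (I s / s)%:E * (2%:E * \int[mu]_(x in `](s / 2)%R, t[) b x + G t))%E.
Proof.
move=> It Is st; have [[s0 _] [_ t1]] := (proj1 (I01E s) Is, proj1 (I01E t) It).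
have int0 : (0 <= 2%:E * \int[mu]_(x in `](s / 2)%R, t[) b x)%E.
  rewrite mule_ge0 ?lee_fin //; apply: integral_ge0 => x xst.
  by apply/quotient_fstar_ge0/(subitv_I01 (s / 2) t) => //; lra.
apply: lee_wpmul2l; first by rewrite lee_fin quasiconcave_ratio_ge0.
apply: ge_ereal_sup => _ [r /= + <-]; rewrite in_itv /= => /andP[sr r1].
have Ir : I01 r by apply/I01E; split=> //; exact: lt_le_trans sr.
have [tr|rt] := leP t r.
  rewrite -[leLHS]add0e; apply: leeD => //; apply: ereal_sup_ubound.
  by exists r => //=; rewrite in_itv /= tr.
apply: le_trans (weighted_fstar_le _ Ir) _; rewrite -[leLHS]adde0.
apply: leeD; last exact: weighted_sup_ge0.
(* The interval (r/2, r) lies in (s/2, t) because s <= r < t. *)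
by apply: lee_wpmul2l; [rewrite lee_fin|apply: integral_quotient_le; lra].
Qed.

(** Let w be a term of the supremum, of index r >= 2s. For r/3 < x < r, monotonicity of [fstar f]
    and [I] gives h(x) >= w/3. This interval is longer than s, so no level below w/3 is admissible
    in [fstar h s]. *)
Lemma weighted_sup_double_le s : I01 s -> s < 2^-1 ->
  (G (2 * s) <= 3%:E * fstar h s)%E.
Proof.
move=> /I01E[s0 _] s2; apply: ge_ereal_sup => _ [r /= + <-].
rewrite in_itv /= => /andP[sr r1].
have Ir : I01 r by apply/I01E; split=> //; lra.
have [r0 Ir0] := (proj1 (proj1 (I01E r) Ir), quasiconcave_gt0 _ qI _ Ir).
set w := ((r / I r)%:E * fstar f r)%E.
suff : (3^-1%:E * w <= fstar h s)%E.
  move=> /(lee_wpmul2l (_ : 0 <= 3%:E)%E) H; apply: le_trans (H _); last by rewrite lee_fin.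
  by rewrite muleA -EFinM divff // mul1e.
apply: le_ereal_inf_tmp => _ [l [l0 hl] <-]; rewrite leNgt; apply/negP => lw.
(* A level l < w/3 would be exceeded by [h] on all of (r/3, r), forcing 2r/3 <= s against 0 < 2s <=
   r. *)
have : ((r - r / 3)%:E <= s%:E :> \bar R)%E; last by rewrite lee_fin; lra.
apply: le_trans hl; rewrite -(lebesgue_itv (r / 3) r false true); last lra.
have mh := measurable_superlevel _ l (proj1 (Mplus_weighted_fss _ qI f)).
apply: le_measure; rewrite ?inE; [exact: measurable_itv|exact: mh|].
move=> x /= xr; have Ix : I01 x by apply: (subitv_I01 (r / 3) r) => //; lra.
split=> //; rewrite gee0_abs; last exact: (proj2 (Mplus_weighted_fss _ qI f)).
move: xr; rewrite in_itv /= => /andP[rx xr].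
apply: (lt_le_trans lw); rewrite /h weighted_fssE //.
have Fx : (x%:E * fstar f r <= fstar_int f x)%E.
  have -> : (x%:E * fstar f r = \int[mu]_(z in `]0%R, x[) fstar f r)%E.
    by rewrite integral_cst_itv ?subr0 1?muleC //; lra.
  apply: ge0_le_integral => /=; first exact: measurable_itv.
  - by move=> z _; exact: fstar_ge0.
  - exact: measurable_cst.
  - exact: measurable_fstar.
  - by move=> z; rewrite /= in_itv /= => /andP[_ zx]; apply: fstar_nonincreasing; lra.
apply: (@le_trans _ _ ((I r)^-1%:E * (x%:E * fstar f r))%E).
  rewrite /w !muleA -!EFinM; apply: lee_wpmul2r; first exact: fstar_ge0.
  by rewrite lee_fin mulrA mulrC ler_pM2l ?invr_gt0 //; lra.
apply: lee_pmul => //; rewrite ?lee_fin ?invr_ge0 ?(ltW Ir0) //.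
  by rewrite mule_ge0 ?fstar_ge0 // lee_fin; lra.
by apply: quasiconcave_inv_le => //; lra.
Qed.

(** * Consequences of the averaging condition on [I] *)

Section Averaging.
Variable C : R.
Hypothesis C0 : 0 < C.
Hypothesis avgI : forall t, I01 t ->
  (\int[mu]_(s in `]0%R, t[) (I s / s)%:E <= (C * I t)%:E)%E.

Let a s := (I s / s)%:E.

(** After exchanging the integrals, the inner one is that of I(s)/s up to y = min(2x, t). Averaging
    bounds it by C I(y) <= 2 C I(x), and I(x) cancels against the denominator of [b]. *)
Lemma integral_ratio_quotient_le t : I01 t ->
  (\int[mu]_(s in `]0%R, t[) (a s * \int[mu]_(x in `](s / 2)%R, t[) b x)
   <= (2 * C)%:E * fstar_int f t)%E.
Proof.
move=> It; have [t0 t1] := proj1 (I01E t) It.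
have sub y : y <= t -> `]0, y[ `<=` @I01 R by move=> yt; apply: subitv_I01 => //; lra.
have a0 s : s \in `]0, t[ -> (0 <= a s)%E.
  by move=> /(sub t (lexx _)) Is; rewrite lee_fin quasiconcave_ratio_ge0.
have b0 s : s \in `]0, t[ -> (0 <= b s)%E.
  by move=> /(sub t (lexx _)); exact: quotient_fstar_ge0.
have ma y : y <= t -> measurable_fun `]0, y[ a.
  by move=> yt; exact: (measurable_funS measurable_I01 (sub _ yt) (measurable_ratio _ qI)).
have mb : measurable_fun `]0, t[ b by apply: measurable_quotient_fstar; exact: sub.
have -> : (\int[mu]_(s in `]0%R, t[) (a s * \int[mu]_(x in `](s / 2)%R, t[) b x) =
    \int[mu]_(s in `]0%R, t[) \int[mu]_(x in `](s / 2)%R, t[) (a s * b x))%E.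
  apply: eq_integral => s; rewrite inE /= => st.
  have s0 : 0 < s by move: st; rewrite in_itv /= => /andP[].
  have sub' : `](s / 2), t[ `<=` `]0, t[.
    by move=> x /=; rewrite !in_itv /= => /andP[sx ->]; rewrite andbT; lra.
  have mb' := measurable_funS (measurable_itv _) sub' mb.
  rewrite (ge0_integralZl (@lebesgue_measure R) (measurable_itv _) mb') ?a0 //.
  by move=> x /sub'; exact: b0.
rewrite tonelli_triangle //; last exact: ma.
pose M x := (\int[mu]_(s in `]0%R, (Num.min (2 * x) t)%R[) a s)%E.
have mint x : Num.min (2 * x) t <= t by rewrite ge_min lexx orbT.
have sa x s : s \in `]0, Num.min (2 * x) t[ -> (0 <= a s)%E.
  move=> smin; apply: a0; move: smin; rewrite !in_itv /= => /andP[-> smin].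
  exact: lt_le_trans (mint x).
have M0 x : (0 <= M x)%E by apply: integral_ge0 => s /= /sa.
have mM : measurable_fun `]0, t[ M.
  apply: nondecreasing_emeasurable; first exact: interval_is_interval.
  move=> x y _ _ xy; apply: ge0_subset_integral; try exact: measurable_itv.
  - by apply: ma; exact: mint.
  - by move=> s /= /sa.
  - move=> s /=; rewrite !in_itv /= !lt_min => /andP[-> /andP[sx ->]].
    by rewrite andbT /=; lra.
have -> : (\int[mu]_(x in `]0%R, t[) \int[mu]_(s in `]0%R, (Num.min (2 * x) t)%R[) (a s * b x) =
    \int[mu]_(x in `]0%R, t[) (M x * b x))%E.
  apply: eq_integral => x; rewrite inE /= => xt.
  rewrite (ge0_integralZr (@lebesgue_measure R) (measurable_itv _) (ma _ (mint x))) ?b0 //.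
  by move=> s /= /sa.
have mf : measurable_fun `]0, t[ (fstar f) by exact: measurable_fstar.
rewrite /fstar_int -(ge0_integralZl (@lebesgue_measure R) (measurable_itv _) mf); last 2 first.
- by move=> x _; exact: fstar_ge0.
- by rewrite lee_fin mulr_ge0 // ltW.
apply: ge0_le_integral; first exact: measurable_itv.
- by move=> x /= xt; rewrite mule_ge0 // b0.
- exact: emeasurable_funM.
- by apply: emeasurable_funM => //; exact: measurable_fstar.
move=> x /= xt; have Ix := sub t (lexx _) x xt.
move: xt; rewrite in_itv /= => /andP[x0 xt].
(* The cap at t keeps y inside (0, 1), where the averaging condition applies, and x <= y <= 2x
   allows doubling. *)
set y := Num.min (2 * x) t.
have xy : x <= y by rewrite /y le_min (ltW xt) andbT; lra.
have y2x : y <= 2 * x by rewrite /y ge_min lexx.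
have Iy : I01 y by apply/I01E; split; [lra|exact: le_lt_trans (mint x) t1].
have Ix0 := quasiconcave_gt0 _ qI _ Ix.
apply: (@le_trans _ _ ((C * I y)%:E * b x)%E).
  by apply: lee_wpmul2r; [exact: quotient_fstar_ge0|exact: avgI].
rewrite /b muleA -EFinM; apply: lee_wpmul2r; first exact: fstar_ge0.
rewrite lee_fin ler_pdivrMr // [2 * C]mulrC -mulrA ler_pM2l //.
exact: quasiconcave_double.
Qed.
(** Integrate the bound of [T_I_le] over s in (0, t). The double integral gives 2 times 2C times
    F(t); G(t) does not depend on s, and averaging bounds the integral of its coefficient I(s)/s. *)
Lemma fstar_int_T_I_le t : I01 t ->
  (fstar_int (T_I I f) t <= (4 * C)%:E * fstar_int f t + (C * I t)%:E * G t)%E.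
Proof.
move=> It; have [t0 t1] := proj1 (I01E t) It.
have sub : `]0, t[ `<=` @I01 R by apply: subitv_I01 => //; exact: ltW.
pose B s := (\int[mu]_(x in `](s / 2)%R, t[) b x)%E.
have subB s : 0 < s -> `](s / 2), t[ `<=` @I01 R.
  by move=> s0; apply: subitv_I01; rewrite ?(ltW t1) // divr_ge0 // ltW.
have B0 s : 0 < s -> (0 <= B s)%E.
  by move=> s0; apply: integral_ge0 => x /(subB _ s0); exact: quotient_fstar_ge0.
have mB : measurable_fun `]0, t[ B.
  apply: nonincreasing_emeasurable; first exact: interval_is_interval.
  move=> s r; rewrite !inE /= !in_itv /= => /andP[s0 _] _ sr.
  apply: integral_quotient_le; rewrite ?(ltW t1) //; first by rewrite divr_ge0 // ltW.
  by rewrite ler_pM2r.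
have ma : measurable_fun `]0, t[ a.
  exact: (measurable_funS measurable_I01 sub (measurable_ratio _ qI)).
have mT : measurable_fun `]0, t[ (T_I I f).
  exact: (measurable_funS measurable_I01 sub (proj1 (Mplus_T_I _ qI f))).
have a0 s : `]0, t[%classic s -> (0 <= a s)%E.
  by move=> /sub Is; rewrite lee_fin quasiconcave_ratio_ge0.
have G0 : (0 <= G t)%E by exact: weighted_sup_ge0.
have aB0 s : `]0, t[%classic s -> (0 <= a s * B s)%E.
  by move=> st; rewrite mule_ge0 ?a0 // B0 //; case/sub/I01E : st.
have maB : measurable_fun `]0, t[ (fun s => a s * B s)%E by exact: emeasurable_funM.
have m1 : measurable_fun `]0, t[ (fun s => 2%:E * (a s * B s))%E by exact: emeasurable_funM.
have m2 : measurable_fun `]0, t[ (fun s => a s * G t)%E by exact: emeasurable_funM.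
have le1 : (fstar_int (T_I I f) t <= \int[mu]_(s in `]0%R, t[) T_I I f s)%E.
  apply: ge0_le_integral => //.
  - by move=> s _; exact: fstar_ge0.
  - exact: measurable_fstar.
  - by move=> s /sub Is; exact: fstar_T_I_le.
apply: (le_trans le1).
apply: (@le_trans _ _ (\int[mu]_(s in `]0%R, t[) (2%:E * (a s * B s) + a s * G t))%E).
  apply: ge0_le_integral => //.
  - by move=> s /sub Is; exact: T_I_ge0.
  - exact: emeasurable_funD.
  - move=> s st; have Is := sub _ st.
    have [s0 _] := proj1 (I01E s) Is.
    rewrite muleCA -ge0_muleDr //; last by rewrite mule_ge0 // ?lee_fin // B0.
    by apply: T_I_le => //; move: st; rewrite /= in_itv /= => /andP[].
rewrite (ge0_integralD (@lebesgue_measure R) (measurable_itv _) _ m1 _ m2); last 2 first.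
- by move=> s st; rewrite mule_ge0 ?lee_fin // aB0.
- by move=> s st; rewrite mule_ge0 // a0.
apply: leeD.
  rewrite (ge0_integralZl (@lebesgue_measure R) (measurable_itv _) maB) ?lee_fin //.
  rewrite (_ : 4 * C = 2 * (2 * C)); last by ring.
  rewrite EFinM -muleA; apply: lee_wpmul2l; first by rewrite lee_fin.
  exact: integral_ratio_quotient_le.
rewrite (ge0_integralZr (@lebesgue_measure R) (measurable_itv _) ma) //.
by apply: lee_wpmul2r => //; exact: avgI.
Qed.

Lemma weighted_fss_T_I_le t : I01 t ->
  ((t / I t)%:E * fss (T_I I f) t <= (4 * C)%:E * h t + C%:E * G t)%E.
Proof.
move=> It; have It0 := quasiconcave_gt0 _ qI _ It.
have G0 : (0 <= G t)%E by exact: weighted_sup_ge0.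
rewrite (weighted_fssE I (T_I I f) t It) /h (weighted_fssE I f t It).
apply: (@le_trans _ _ ((I t)^-1%:E *
    ((4 * C)%:E * fstar_int f t + (C * I t)%:E * G t))%E).
  by apply: lee_wpmul2l; [rewrite lee_fin invr_ge0 ltW|exact: fstar_int_T_I_le].
rewrite ge0_muleDr; last 2 first.
- by rewrite mule_ge0 ?fstar_int_ge0 // lee_fin mulr_ge0 // ltW.
- by rewrite mule_ge0 // lee_fin mulr_ge0 // ltW.
by rewrite muleCA [X in (_ + X)%E]muleA -EFinM mulrCA mulVf ?mulr1 // gt_eqF.
Qed.

(** The constant is 10 = 4 + 6: the term in [h] gives 4, and the term in [G] gives 2 * 3, with 2
    from dilation and 3 from [weighted_sup_double_le]. *)
Lemma ri_norm_weighted_fss_T_I_le (rho : (R -> \bar R) -> \bar R) : ri_norm rho ->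
  (rho (fun t => (t / I t)%:E * fss (T_I I f) t) <= (10 * C)%:E * rho h)%E.
Proof.
move=> rirho; have Mh : Mplus h by exact: Mplus_weighted_fss.
have MG : Mplus G.
  apply: Mplus_nonincreasing; first by move=> t; exact: weighted_sup_ge0.
  exact: weighted_sup_nonincreasing.
have rG : (rho G <= (2 * 3)%:E * rho h)%E.
  apply: ri_norm_le_dilation => //.
  - by move=> t; exact: weighted_sup_ge0.
  - exact: weighted_sup_nonincreasing.
  - exact: weighted_sup_double_le.
case: rirho => [rho0 [_ [rhoZ [rhoD [rho_le _]]]]].
have MZ (u : R -> \bar R) (c : R) : 0 <= c -> Mplus u -> Mplus (fun t => c%:E * u t)%E.
  move=> c0 [mu_ u0]; split=> [|t It]; first exact: emeasurable_funM.
  by rewrite mule_ge0 ?lee_fin // u0.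
have C4 : 0 <= 4 * C by rewrite mulr_ge0 // ltW.
have M1 := MZ _ _ C4 Mh.
have M2 := MZ _ _ (ltW C0) MG.
have M12 : Mplus (fun t => (4 * C)%:E * h t + C%:E * G t)%E.
  split=> [|t It]; first by apply: emeasurable_funD; [case: M1|case: M2].
  by rewrite adde_ge0 //; [case: M1 => _; exact|case: M2 => _; exact].
apply: (@le_trans _ _ (rho (fun t => (4 * C)%:E * h t + C%:E * G t)%E)).
  apply: rho_le; [exact: M12|exact: (Mplus_weighted_fss _ qI (T_I I f))|].
  by exists set0; split=> // t It _; exact: weighted_fss_T_I_le.
apply: (le_trans (rhoD _ _ M1 M2)); rewrite !rhoZ ?(ltW C0) //.
rewrite (_ : 10 * C = 4 * C + C * (2 * 3)); last by ring.
rewrite EFinD ge0_muleDl ?lee_fin // ?mulr_ge0 ?(ltW C0) //.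
apply: leeD => //; rewrite EFinM -muleA.
by apply: lee_wpmul2l => //; rewrite lee_fin ltW.
Qed.
End Averaging.
End Estimates.

Theorem theorem3p14 (R : realType) (rho : (R -> \bar R) -> \bar R) (I : R -> R) :
  ri_norm rho -> quasiconcave I ->
  (exists C : R, forall t, I01 t ->
     (\int[@lebesgue_measure R]_(s in `]0%R, t[) (I s / s)%:E <= (C * I t)%:E)%E) ->
  exists C : R, 0 < C /\ forall f : R -> \bar R, Mplus f ->
    (rho (fun t => ((t / I t)%:E * fss (T_I I f) t)%E)
      <= C%:E * rho (fun t => ((t / I t)%:E * fss f t)%E))%E.
Proof.
(* The given C need not come with a sign, while the estimates ask for a positive constant; enlarging
   C preserves the averaging inequality since I(t) > 0. *)
move=> rirho qI [C avgI]; pose D := Num.max C 1.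
have D0 : 0 < D by rewrite lt_max ltr01 orbT.
exists (10 * D); split=> [|f _]; first by rewrite mulr_gt0.
apply: ri_norm_weighted_fss_T_I_le => // t It; apply: (le_trans (avgI t It)).
by rewrite lee_fin ler_wpM2r ?le_max ?lexx // ltW // quasiconcave_gt0.
Qed.
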